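(* The modal logic $\mathbf{GV}=\Gamma(\mathbf{LV},1,1)$ has the uniform Lyndon interpolation property (and hence the Lyndon interpolation property).
   Context: Modal formulas use variables, $\bot,\land,\lor,\neg,\to,\Box$. Positive/negative variables: $v^+(p)=\{p\}$, $v^-(p)=\emptyset$, $v^\circ(\bot)=\emptyset$, $\land,\lor,\Box$ preserve polarity, $v^\pm(\neg\varphi)=v^\mp(\varphi)$, $v^+(\varphi\to\psi)=v^-(\varphi)\cup v^+(\psi)$, $v^-(\varphi\to\psi)=v^+(\varphi)\cup v^-(\psi)$. $\mathbf{GV}$ is the set of modal formulas true at every world of every Kripke model on the frame $(W,R)$ with $W=\{r,a,b\}$ and $R$ the reflexive closure of $\{(r,a),(r,b)\}$ (a root below two distinct final points). A logic $L$ has the uniform Lyndon interpolation property iff for every formula $\varphi$ and finite sets $P^+,P^-$ of variables there is $\theta$ with $L\vdash\varphi\to\theta$, $v^\circ(\theta)\subseteq v^\circ(\varphi)\setminus P^\circ$ for $\circ\in\{+,-\}$, and $L\vdash\theta\to\psi$ for every $\psi$ with $L\vdash\varphi\to\psi$ and $v^\circ(\psi)\cap P^\circ=\emptyset$ for $\circ\in\{+,-\}$. $L$ has the Lyndon interpolation property iff whenever $L\vdash\varphi\to\psi$ there is $\rho$ with $v^\circ(\rho)\subseteq v^\circ(\varphi)\cap v^\circ(\psi)$ for $\circ\in\{+,-\}$, $L\vdash\varphi\to\rho$ and $L\vdash\rho\to\psi$. *)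

(* Defs.v *)
From HB Require Import structures.
From mathcomp Require Import all_boot finmap.

Set Implicit Arguments.
Unset Strict Implicit.
Unset Printing Implicit Defensive.

Local Open Scope fset_scope.

Definition var := nat.

Inductive form : Type :=
| Var of var
| Bot
| And of form & form
| Or of form & form
| Neg of form
| Imp of form & form
| Box of form.

Inductive polarity : Type := PosPol | NegPol.

Definition flip (o : polarity) : polarity :=
  match o with PosPol => NegPol | NegPol => PosPol end.

Fixpoint v (o : polarity) (phi : form) : {fset var} :=
  match phi with
  | Var p => match o with PosPol => [fset p] | NegPol => fset0 end
  | Bot => fset0
  | And phi1 phi2 | Or phi1 phi2 => v o phi1 `|` v o phi2
  | Neg phi1 => v (flip o) phi1
  | Imp phi1 phi2 => v (flip o) phi1 `|` v o phi2
  | Box phi1 => v o phi1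
  end.

Fixpoint sat (W : finType) (R : rel W) (V : var -> {set W}) (w : W)
    (phi : form) : bool :=
  match phi with
  | Var p => w \in V p
  | Bot => false
  | And phi1 phi2 => sat R V w phi1 && sat R V w phi2
  | Or phi1 phi2 => sat R V w phi1 || sat R V w phi2
  | Neg phi1 => ~~ sat R V w phi1
  | Imp phi1 phi2 => sat R V w phi1 ==> sat R V w phi2
  | Box phi1 => [forall u, R w u ==> sat R V u phi1]
  end.

Definition frame_logic (W : finType) (R : rel W) (phi : form) : Prop :=
  forall (V : var -> {set W}) (w : W), sat R V w phi.

Inductive gv_world : Type := gv_r | gv_a | gv_b.

Definition gv_code (w : gv_world) : option bool :=
  match w with gv_r => None | gv_a => Some true | gv_b => Some false end.

Definition gv_decode (i : option bool) : gv_world :=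
  match i with None => gv_r | Some true => gv_a | Some false => gv_b end.

Lemma gv_codeK : cancel gv_code gv_decode.
Proof. by case. Qed.

HB.instance Definition _ := Finite.copy gv_world (can_type gv_codeK).

Definition gv_rel : rel gv_world := fun x y =>
  (x == y) || ((x, y) \in [:: (gv_r, gv_a); (gv_r, gv_b)]).

Definition GV : form -> Prop := frame_logic gv_rel.

Definition uniform_Lyndon_interpolation (L : form -> Prop) : Prop :=
  forall (phi : form) (P : polarity -> {fset var}),
  exists theta : form,
    [/\ L (Imp phi theta),
        forall o, v o theta `<=` v o phi `\` P o
      & forall psi : form, L (Imp phi psi) ->
          (forall o, v o psi `&` P o = fset0) ->
          L (Imp theta psi)].

Definition Lyndon_interpolation (L : form -> Prop) : Prop :=
  forall phi psi : form, L (Imp phi psi) ->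
  exists rho : form,
    [/\ forall o, v o rho `<=` v o phi `&` v o psi,
        L (Imp phi rho)
      & L (Imp rho psi)].

(* Main.v *)
From mathcomp Require Import all_boot finmap.
Require Import Defs.

(** Every pointed [GV]-model is a p-morphic image of the root, so only models
    at the root matter. There, [phi] has as uniform Lyndon interpolant the
    disjunction, over the models [N] of [phi], of a formula [diagram] saying
    that [N] simulates into the current model with respect to the retained
    polarised variables. With exactly two final points, a relation between two
    pairs of final points that is total and surjective contains a perfect
    matching; hence, up to swapping [a] and [b], a simulation is a worldwise
    comparison of valuations, and two valuations compared on the common
    variables can be interpolated variable by variable. *)

Set Implicit Arguments.
Unset Strict Implicit.
Unset Printing Implicit Defensive.

Local Open Scope fset_scope.

Section Semantics.

Variables (W : finType) (R : rel W).
Implicit Types (V : var -> {set W}) (w : W) (phi : form).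

Definition carries (o : polarity) (A B : {set W}) : bool :=
  match o with PosPol => A \subset B | NegPol => B \subset A end.

Lemma carriesC o A B : carries (flip o) A B = carries o B A.
Proof. by case: o. Qed.

Lemma flipK : involutive flip.
Proof. by case. Qed.

(** [Neg] and the antecedent of [Imp] flip the polarity and exchange the two valuations, so the
    induction ranges over both. *)
Lemma sat_mono V V' phi :
  (forall o p, p \in v o phi -> carries o (V p) (V' p)) ->
  forall w, sat R V w phi -> sat R V' w phi.
Proof.
elim: phi V V' => [p||f IHf g IHg|f IHf g IHg|f IHf|f IHf g IHg|f IHf] V V' H w //=.
- by apply/subsetP: w; apply: (H PosPol); rewrite inE.
- have /IHf Hf o p : p \in v o f -> carries o (V p) (V' p).
    by move=> pf; apply: H; rewrite inE pf.
  have /IHg Hg o p : p \in v o g -> carries o (V p) (V' p).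
    by move=> pg; apply: H; rewrite inE pg orbT.
  by case/andP=> /Hf-> /Hg->.
- have /IHf Hf o p : p \in v o f -> carries o (V p) (V' p).
    by move=> pf; apply: H; rewrite inE pf.
  have /IHg Hg o p : p \in v o g -> carries o (V p) (V' p).
    by move=> pg; apply: H; rewrite inE pg orbT.
  by case/orP=> [/Hf->|/Hg->]; rewrite ?orbT.
- have /IHf Hf o p : p \in v o f -> carries o (V' p) (V p).
    by move=> pf; rewrite -carriesC; apply: H; rewrite /= flipK.
  by apply: contra => /Hf.
- have /IHf Hf o p : p \in v o f -> carries o (V' p) (V p).
    by move=> pf; rewrite -carriesC; apply: H; rewrite /= inE flipK pf.
  have /IHg Hg o p : p \in v o g -> carries o (V p) (V' p).
    by move=> pg; apply: H; rewrite inE pg orbT.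
  by move/implyP=> fg; apply/implyP => /Hf/fg/Hg.
- move/forallP=> all_f; apply/forallP => u; apply/implyP => /(implyP (all_f u)).
  exact: IHf.
Qed.

Lemma sat_bigOr (I : Type) (s : seq I) (P : pred I) F V w :
  sat R V w (\big[Or/Bot]_(i <- s | P i) F i) =
  has (fun i => P i && sat R V w (F i)) s.
Proof.
by elim: s => [|i s IHs]; rewrite ?big_nil// big_cons /=; case: (P i); rewrite /= IHs.
Qed.

Lemma sat_bigAnd (I : Type) (s : seq I) (P : pred I) F V w :
  sat R V w (\big[And/Neg Bot]_(i <- s | P i) F i) =
  all (fun i => P i ==> sat R V w (F i)) s.
Proof.
by elim: s => [|i s IHs]; rewrite ?big_nil// big_cons /=; case: (P i); rewrite /= IHs.
Qed.

End Semantics.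

Definition pullback (W W' : finType) (f : W -> W') (V : var -> {set W'}) :=
  fun p => f @^-1: V p.

Definition p_morphism (W W' : finType) (R : rel W) (R' : rel W') (f : W -> W') :=
  (forall x y, R x y -> R' (f x) (f y)) /\
  (forall x z, R' (f x) z -> exists2 y, R x y & f y = z).

Lemma sat_pullback (W W' : finType) (R : rel W) (R' : rel W') f V phi x :
  p_morphism R R' f -> sat R (pullback f V) x phi = sat R' V (f x) phi.
Proof.
case=> forth back.
elim: phi x => [p||g IHg h IHh|g IHg h IHh|g IHg|g IHg h IHh|g IHg] x /=;
  rewrite ?inE ?IHg ?IHh //.
apply/forallP/forallP => H y; apply/implyP.
- by case/back=> z xz <-; rewrite -IHg; apply: (implyP (H z)).
- by move=> xy; rewrite IHg; apply: (implyP (H (f y))); apply: forth.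
Qed.

Lemma v_bigOr_sub (I : Type) (s : seq I) (P : pred I) F o (X : {fset var}) :
  (forall i, P i -> v o (F i) `<=` X) ->
  v o (\big[Or/Bot]_(i <- s | P i) F i) `<=` X.
Proof.
move=> FX; apply: (big_ind (fun f => v o f `<=` X)) => //=.
by move=> f g fX gX; rewrite fsubUset fX.
Qed.

Lemma v_bigAnd_sub (I : eqType) (s : seq I) (P : pred I) F o (X : {fset var}) :
  (forall i, i \in s -> P i -> v o (F i) `<=` X) ->
  v o (\big[And/Neg Bot]_(i <- s | P i) F i) `<=` X.
Proof.
move=> FX; rewrite big_seq_cond.
apply: (big_ind (fun f => v o f `<=` X)) => /=; first exact: fsub0set.
  by move=> f g fX gX; rewrite fsubUset fX.
by move=> i /andP[]; apply: FX.
Qed.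

Lemma forall_gv (P : pred gv_world) : [forall u, P u] = [&& P gv_r, P gv_a & P gv_b].
Proof.
apply/forallP/and3P => [H|[Hr Ha Hb]]; first by split; apply: H.
by case.
Qed.

Lemma sat_gv_Box V w phi :
  sat gv_rel V w (Box phi) =
  match w with
  | gv_r => [&& sat gv_rel V gv_r phi, sat gv_rel V gv_a phi & sat gv_rel V gv_b phi]
  | _ => sat gv_rel V w phi
  end.
Proof. by rewrite [LHS]/= forall_gv; case: w; rewrite /= ?andbT. Qed.

Definition from_root (w x : gv_world) : gv_world := if w is gv_r then x else w.

(** A final point sees only itself, so the constant map onto it satisfies the back condition. *)
Lemma from_root_p_morphism w : p_morphism gv_rel gv_rel (from_root w).
Proof.
split; first by case: w => [||] [] [].
case: w => x z xz; first by exists z.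
- by exists x; [case: x {xz} | case: z xz].
- by exists x; [case: x {xz} | case: z xz].
Qed.

Lemma sat_from_root V w phi :
  sat gv_rel (pullback (from_root w) V) gv_r phi = sat gv_rel V w phi.
Proof. by rewrite (sat_pullback _ _ _ (from_root_p_morphism w)); case: w. Qed.

Lemma GV_root phi : (forall V, sat gv_rel V gv_r phi) -> GV phi.
Proof. by move=> H V w; rewrite -sat_from_root. Qed.

Definition gv_swap (b : bool) (x : gv_world) : gv_world :=
  if b then match x with gv_r => gv_r | gv_a => gv_b | gv_b => gv_a end else x.

Lemma gv_swap_p_morphism b : p_morphism gv_rel gv_rel (gv_swap b).
Proof.
split; first by case: b => [] [] [].
by case: b => [] [] [] // _; solve [by exists gv_r | by exists gv_a | by exists gv_b].
Qed.

Definition Dia (phi : form) : form := Neg (Box (Neg phi)).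

Lemma sat_gv_Dia V w phi :
  sat gv_rel V w (Dia phi) =
  match w with
  | gv_r => [|| sat gv_rel V gv_r phi, sat gv_rel V gv_a phi | sat gv_rel V gv_b phi]
  | _ => sat gv_rel V w phi
  end.
Proof.
rewrite [LHS]/(~~ sat gv_rel V w (Box (Neg phi))) sat_gv_Box.
by case: w => /=; do ?[case: (sat _ _ _ phi)].
Qed.

(* [Dia (Box A)] says that some final point satisfies [A], and [Box (Dia A)] that
   all final points do. *)
Definition diagram (L : gv_world -> form) : form :=
  And (L gv_r) (And (And (Dia (Box (L gv_a))) (Dia (Box (L gv_b))))
                    (Box (Dia (Or (L gv_a) (L gv_b))))).

Lemma v_diagram L o X : (forall x, v o (L x) `<=` X) -> v o (diagram L) `<=` X.
Proof. by move=> LX; rewrite /= !flipK !fsubUset !LX. Qed.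

Lemma sat_diagram V L :
  reflect (exists b, forall x, sat gv_rel V (gv_swap b x) (L x))
          (sat gv_rel V gv_r (diagram L)).
Proof.
have satA w f g : sat gv_rel V w (And f g) = sat gv_rel V w f && sat gv_rel V w g by [].
rewrite /diagram !satA !(sat_gv_Dia, sat_gv_Box) /=.
apply: (iffP idP) => [H|[b Hb]].
- have [/and3P[Hr Ha Hb]|H'] := boolP [&& sat gv_rel V gv_r (L gv_r),
      sat gv_rel V gv_a (L gv_a) & sat gv_rel V gv_b (L gv_b)].
    by exists false; case.
  (* If [L gv_a] fails at [gv_a], it holds at [gv_b], and [gv_a] must satisfy [L gv_b]; the failure
     of [L gv_b] at [gv_b] is symmetric. The seven truth values are that of [L gv_r] at the root and
     those of [L gv_a], [L gv_b] at all three worlds. *)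
  exists true => -[]; move: H H' => /=;
    by do 7 case: (sat gv_rel V _ _) => //=.
- have := Hb gv_r; have := Hb gv_a; have := Hb gv_b.
  by case: (b) => /= -> -> ->; rewrite ?orbT.
Qed.

Section Literals.

Variables (Q : polarity -> {fset var}) (N : var -> {set gv_world}).

(** Recording positive variables only where true and negative ones only where false keeps each
    occurrence in its permitted polarity. *)
Definition literals (x : gv_world) : form :=
  And (\big[And/Neg Bot]_(p <- Q PosPol | x \in N p) Var p)
      (\big[And/Neg Bot]_(p <- Q NegPol | x \notin N p) Neg (Var p)).

Lemma v_literals o x : v o (literals x) `<=` Q o.
Proof.
rewrite /= fsubUset !v_bigAnd_sub// => p pQ _; case: o pQ => //= pQ;
  by rewrite ?fsub0set ?fsub1set.
Qed.

Lemma sat_literals (V : var -> {set gv_world}) w x :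
  reflect ((forall p, p \in Q PosPol -> x \in N p -> w \in V p) /\
           (forall p, p \in Q NegPol -> w \in V p -> x \in N p))
          (sat gv_rel V w (literals x)).
Proof.
rewrite /= !sat_bigAnd; apply: (iffP andP) => -[Hp Hn]; split.
- by move=> p /(allP Hp)/implyP.
- by move=> p /(allP Hn)/implyP /= H wV; apply: contraLR wV => /H.
- by apply/allP => p pQ; apply/implyP => /(Hp p pQ).
- by apply/allP => p pQ; apply/implyP; apply: contra => /(Hn p pQ).
Qed.

End Literals.

(** Valuations on a finite [S] form a finite type, so a disjunction over them is a formula; the
    default off [S] does not affect formulas with all variables in [S]. *)
Definition extend (W : finType) (S : {fset var}) (N : {ffun S -> {set W}}) (p : var) :
    {set W} :=
  if insub p is Some s then N s else set0.

Lemma extend_restrict (W : finType) (S : {fset var}) (V : var -> {set W}) p :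
  p \in S -> extend [ffun s : S => V (val s)] p = V p.
Proof. by move=> pS; rewrite /extend insubT ffunE. Qed.

Lemma GV_uniform_Lyndon_interpolation : uniform_Lyndon_interpolation GV.
Proof.
move=> phi P; pose S := v PosPol phi `|` v NegPol phi.
pose Q o := v o phi `\` P o.
have vS o p : p \in v o phi -> p \in S by rewrite inE; case: o => ->; rewrite ?orbT.
exists (\big[Or/Bot]_(N <- enum {ffun S -> {set gv_world}} |
          sat gv_rel (extend N) gv_r phi) diagram (literals Q (extend N))); split.
- apply: GV_root => V /=; apply/implyP => phiV; rewrite sat_bigOr.
  apply/hasP; exists [ffun s : S => V (val s)]; first by rewrite mem_enum.
  apply/andP; split.
    apply: sat_mono phiV => o p pphi.
    by rewrite extend_restrict ?(vS o)//; case: o {pphi} => /=; apply: subxx.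
  apply/sat_diagram; exists false => x; apply/sat_literals; split=> p /fsetDP[pphi _];
    by rewrite extend_restrict ?(vS _ _ pphi).
- by move=> o; apply: v_bigOr_sub => N _; apply: v_diagram => x; apply: v_literals.
- move=> psi phi_psi psiP; apply: GV_root => V /=; apply/implyP.
  rewrite sat_bigOr => /hasP[N _ /andP[phiN]].
  case/sat_diagram=> b; set V' := pullback (gv_swap b) V => HN.
  (* The automorphism [gv_swap b] fixes the root, so [psi] may be tested under [V'], where the
     matching with [N] is the identity. *)
  suff: sat gv_rel V' gv_r psi.
    by rewrite (sat_pullback _ _ _ (gv_swap_p_morphism b)); case: (b).
  have NV' x p : p \in Q PosPol -> x \in extend N p -> x \in V' p.
    by move=> pQ xN; rewrite inE; case/sat_literals: (HN x) => + _; apply.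
  have V'N x p : p \in Q NegPol -> x \in V' p -> x \in extend N p.
    by rewrite [_ \in V' _]inE; case/sat_literals: (HN x) => _; apply.
  (* The least valuation meeting the lower bounds imposed by [phi] and by [psi];
     [NV'] and [V'N] say that it also meets the upper bounds. *)
  pose K p := [set x | (p \in v PosPol phi) && (x \in extend N p)
                       || (p \notin P NegPol) && (x \in V' p)].
  have phiK : sat gv_rel K gv_r phi.
    apply: sat_mono phiN => -[] p pphi /=; apply/subsetP => x; rewrite [_ \in K p]inE.
      by rewrite pphi => ->.
    by case/orP=> /andP[] // pP; apply: V'N; rewrite inE pP.
  have := phi_psi K gv_r; rewrite /= phiK; apply: sat_mono => o p ppsi.
  (* As [psi] avoids [P], a variable positive in both formulas lies in [Q PosPol], where [NV']
     applies; for one negative in [psi], [K] contains [V'] by construction. *)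
  have pP : p \notin P o.
    by apply/negP => pP; have := in_fset0 p; rewrite -(psiP o) inE ppsi pP.
  case: o pP {ppsi} => /= pP; apply/subsetP => x; rewrite [_ \in K p]inE.
    by case/orP=> /andP[] // pphi; apply: NV'; rewrite inE pP.
  by rewrite pP => ->; rewrite orbT.
Qed.

Lemma uniform_Lyndon_interpolation_Lyndon (L : form -> Prop) :
  uniform_Lyndon_interpolation L -> Lyndon_interpolation L.
Proof.
move=> ulip phi psi phi_psi.
(* Forgetting, in each polarity, the variables of [phi] absent from [psi] leaves exactly the common
   ones. *)
have [theta [phi_theta v_theta theta_min]] := ulip phi (fun o => v o phi `\` v o psi).
exists theta; split=> //; first by move=> o; have := v_theta o; rewrite fsetDDr fsetDv fset0U.
apply: theta_min => // o; apply/fsetP => p; rewrite !inE.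
by case: (p \in v o psi).
Qed.

Theorem theorem7p1 :
  uniform_Lyndon_interpolation GV /\ Lyndon_interpolation GV.
Proof.
by split; last apply: uniform_Lyndon_interpolation_Lyndon;
  exact: GV_uniform_Lyndon_interpolation.
Qed.
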